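(* Let $\mathcal{V}$ be a Hilbert space, $\mathcal{V}_h\subset\mathcal{V}_h^{+}\subset\mathcal{V}$ finite dimensional (finite element) subspaces, $B(\cdot,\cdot):\mathcal{V}\times\mathcal{V}\to\mathbb{R}$ a symmetric bilinear form, and $L:\mathcal{V}\to\mathbb{R}$ a linear functional. Let $G$ denote a function that is once differentiable everywhere it is defined, and let $J(u)=G(B(u,u))$. Let $u\in\mathcal{V}$, $u_h\in\mathcal{V}_h$, $u_h^{+}\in\mathcal{V}_h^{+}$, $z\in\mathcal{V}$ and $z_h^{+}\in\mathcal{V}_h^{+}$ solve, respectively, $$B(u,\varphi)=L(\varphi)\quad\forall\varphi\in\mathcal{V},$$ $$B(u_h,\varphi_h)=L(\varphi_h)\quad\forall\varphi_h\in\mathcal{V}_h,$$ $$B(u_h^{+},\varphi_h^{+})=L(\varphi_h^{+})\quad\forall\varphi_h^{+}\in\mathcal{V}_h^{+},$$ $$B(\varphi,z)=J'(u_h;\varphi)\quad\forall\varphi\in\mathcal{V},$$ $$B(\varphi_h^{+},z_h^{+})=J'(u_h;\varphi_h^{+})\quad\forall\varphi_h^{+}\in\mathcal{V}_h^{+}.$$ Then the estimates of $J(u)-J(u_h)$ given by $$\eta_2:=L(z)-B(u_h,z)\qquad\text{and}\qquad\eta_3:=L(z_h^{+})-B(u_h,z_h^{+})$$ are not reliable.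
   Context: Derivatives: $J'(u;v):=\lim_{\varepsilon\to0}\varepsilon^{-1}[J(u+\varepsilon v)-J(u)]$ and $J''(u;v,w):=\lim_{\varepsilon\to0}\varepsilon^{-1}[J'(u+\varepsilon w;v)-J'(u;v)]$. Standing assumptions: $J:\mathcal{V}\to\mathbb{R}$ is a nonlinear functional with sufficient regularity such that its first and second Fréchet derivatives exist (these agree with $J'$ and $J''$), and the problem of finding $u\in\mathcal{V}$ with $B(u,\varphi)=L(\varphi)$ for all $\varphi\in\mathcal{V}$ is well-posed. Definition (reliable): an error estimate $\eta\approx J(u)-J(u_h)$ is said to be reliable if there exists a constant $C\in\mathbb{R}_{>0}$ independent of $u_h$ such that $|J(u)-J(u_h)|\le C|\eta|$.
   Formalization: The formal statement additionally assumes that J(u) − J(u_h) is nonzero for at least one of the discretizations considered; without this (for example G constant, or u in V_h) both estimates and the error vanish and the estimates are trivially reliable. *)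

(* Defs.v *)
(* MathComp / MathComp-Analysis. *)
From HB Require Import structures.
From mathcomp Require Import all_boot all_order all_algebra.
From mathcomp Require Import all_classical all_reals all_analysis.

Set Implicit Arguments.
Unset Strict Implicit.
Unset Printing Implicit Defensive.

Import Order.TTheory GRing.Theory Num.Theory.
Import numFieldNormedType.Exports.

Local Open Scope classical_set_scope.
Local Open Scope ring_scope.

(* S is the span of finitely many vectors; the zero subspace is n = 0. *)
Definition findim_subspace (R : realType) (V : normedModType R) (S : set V) :
    Prop :=
  exists n (e : 'I_n -> V),
    S = [set v | exists c : 'I_n -> R, v = \sum_(i < n) c i *: e i].

(* w is a solution in W of the variational problem
     a(w, phi) = l(phi) for all phi in W.
   The trial function is the first argument of a; for an adjoint problem
   a(phi, w) = l(phi), the form is passed with its arguments exchanged. *)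
Definition solves (R : realType) (V : normedModType R) (W : set V)
    (a : V -> V -> R) (l : V -> R) (w : V) : Prop :=
  W w /\ forall phi, W phi -> a w phi = l phi.

(* Well-posedness in the sense of Hadamard of the problem B(u, .) = L on V:
   existence, uniqueness, and continuous dependence of the solution on the
   right-hand side, M being a bound of the dual norm of L' - L. *)
Definition well_posed (R : realType) (V : normedModType R)
    (B : V -> V -> R) (L : V -> R) : Prop :=
  (exists! u, solves setT B L u) /\
  exists c : R, forall (L' : {scalar V}) (M : R) (u u' : V),
    (forall phi, `|L' phi - L phi| <= M * `|phi|) ->
    solves setT B L u -> solves setT B L' u' -> `|u' - u| <= c * M.

(* The estimate eta h of the error err h = J(u) - J(u_h) is reliable when a
   constant C can be chosen independently of u_h, i.e. uniformly over the
   family of discretizations, indexed by h : I. *)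
Definition reliable (R : realType) (I : Type) (err eta : I -> R) : Prop :=
  exists2 C : R, 0 < C & forall h, `|err h| <= C * `|eta h|.

(* Main.v *)
Require Import Defs.
From HB Require Import structures.
From mathcomp Require Import all_boot all_order all_algebra.
From mathcomp Require Import all_classical all_reals all_analysis.
From mathcomp Require Import ring.

Import Order.TTheory GRing.Theory Num.Theory.
Import numFieldNormedType.Exports.

Local Open Scope classical_set_scope.
Local Open Scope ring_scope.

(** Both estimates vanish identically, so no constant can bound the error by
    them as soon as one discretization has a nonzero error.

    By the chain rule and the symmetry of the form, the goal functional
    J(v) = G(B(v, v)) has the derivative J'(v; phi) = 2 G'(B(v, v)) B(v, phi)
    (lemma [derive_quadratic]).  The right-hand side of the adjoint problem at
    u_h is therefore a multiple of the primal form at u_h itself, and its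
    solution behaves, as a test function, like a multiple of u_h.  The residual
    of u_h is zero at u_h by Galerkin orthogonality, hence also at the adjoint
    solution (lemma [residual_adjoint_eq0]).  The exact adjoint problem and the
    enriched one are two instances of this argument, with the primal solutions
    u and u_h^+ respectively; neither needs the adjoint solution to be
    unique. *)

Lemma symmetricC (R : nzRingType) (V : lmodType R) (B : {symmetric V})
  (x y : V) : B x y = B y x.
Proof. by rewrite hermC /= expr0 mul1r. Qed.

Lemma symmetric_line (R : comNzRingType) (V : lmodType R) (B : {symmetric V})
  (v phi : V) (t : R) :
  B (t *: phi + v) (t *: phi + v) =
  B v v + t * (2 * B v phi) + t ^+ 2 * B phi phi.
Proof.
rewrite (linearDl B) !(linearDr B) !(linearZl_LR B) !(linearZr_LR B) /=.
by rewrite (symmetricC _ _ B phi v); ring.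
Qed.

Lemma derive_quadratic (R : realType) (V : normedModType R)
  (B : {symmetric V}) (G : R -> R) (v phi : V) :
  derivable G (B v v) 1 ->
  'D_phi (fun w => G (B w w)) v = 2 * G^`()%classic (B v v) * B v phi.
Proof.
move=> dG.
pose q (t : R) := B v v + t * (2 * B v phi) + t ^+ 2 * B phi phi.
have q0 : q 0 = B v v by rewrite /q; ring.
have dq : is_derive (0 : R) 1 q (2 * B v phi).
  by apply: is_derive_eq; rewrite /GRing.scale /=; ring.
have dGq : is_derive (q 0) 1 G (G^`()%classic (B v v)).
  by rewrite q0 derive1E; apply: DeriveDef.
(* Along the line of direction phi through v, both difference quotients are
   the same function of the increment. *)
have quotientE :
    (fun t : R =>
       t^-1 *: (((fun w => G (B w w)) \o shift v) (t *: phi) - G (B v v))) =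
    (fun t : R => t^-1 *: ((G \o q \o shift 0) (t *: 1) - (G \o q) 0)).
  apply/funext => t /=.
  by rewrite symmetric_line q0 addr0 /q [t *: 1]mulr1.
rewrite {1}/derive quotientE -/(derive _ _ _).
by rewrite (derive_val (is_derive := is_derive1_comp dGq dq)); ring.
Qed.

(** The space W carries both the primal problem solved by w and the adjoint
    problem solved by z; both L(z) and B(u_h, z) are equal to c L(u_h). *)
Lemma residual_adjoint_eq0 (R : realType) (V : normedModType R)
  (B : {symmetric V}) (L l : V -> R) (c : R) (S W : set V) (uh w z : V) :
  S `<=` W -> solves S B L uh -> solves W B L w ->
  solves W (fun x phi => B phi x) l z ->
  (forall phi, l phi = c * B uh phi) ->
  L z - B uh z = 0.
Proof.
move=> SW [Suh uhE] [Ww wE] [Wz zE] lE.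
rewrite -(wE z Wz) (zE w Ww) (zE uh (SW uh Suh)) !lE.
by rewrite (symmetricC _ _ B uh w) (wE uh (SW uh Suh)) (uhE uh Suh) subrr.
Qed.

Lemma not_reliable_eq0 (R : realType) (I : Type) (err eta : I -> R) :
  (forall h, eta h = 0) -> (exists h, err h <> 0) -> ~ reliable err eta.
Proof.
move=> eta0 [h errh] [C _ /(_ h)].
by rewrite eta0 normr0 mulr0 normr_le0 => /eqP.
Qed.

Theorem theorem3
  (R : realType)
  (V : completeNormedModType R)
  (ip : {dot V for idfun}) (ip_norm : forall v : V, ip v v = `|v| ^+ 2)
  (B : {symmetric V}) (L : {scalar V})
  (D : set R) (G : R -> R)
  (D_open : open D) (G_diff : forall t : R, D t -> derivable G t 1)
  (J : V -> R) (J_def : J = fun v => G (B v v))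
  (J_frechet : forall v : V, D (B v v) -> differentiable J v)
  (BL_wp : well_posed B L)
  (I : Type) (Vh Vhp : I -> set V)
  (Vh_findim : forall h, findim_subspace (Vh h))
  (Vhp_findim : forall h, findim_subspace (Vhp h))
  (Vh_sub : forall h, Vh h `<=` Vhp h)
  (u : V) (uh uhp z zhp : I -> V)
  (u_sol : solves setT B L u)
  (uh_sol : forall h, solves (Vh h) B L (uh h))
  (uhp_sol : forall h, solves (Vhp h) B L (uhp h))
  (u_dom : D (B u u)) (uh_dom : forall h, D (B (uh h) (uh h)))
  (z_sol : forall h,
     solves setT (fun w phi => B phi w) (fun phi => 'D_phi J (uh h)) (z h))
  (zhp_sol : forall h,
     solves (Vhp h) (fun w phi => B phi w) (fun phi => 'D_phi J (uh h)) (zhp h))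
  (J_err : exists h, J u - J (uh h) <> 0) :
  let err := fun h => J u - J (uh h) in
  let eta2 := fun h => L (z h) - B (uh h) (z h) in
  let eta3 := fun h => L (zhp h) - B (uh h) (zhp h) in
  ~ reliable err eta2 /\ ~ reliable err eta3.
Proof.
move=> err eta2 eta3.
have dJ h phi :
    'D_phi J (uh h) = 2 * G^`()%classic (B (uh h) (uh h)) * B (uh h) phi.
  by rewrite J_def; apply/derive_quadratic/G_diff/uh_dom.
split; apply: not_reliable_eq0 => // h.
- exact: residual_adjoint_eq0 (@subsetT _ (Vh h)) (uh_sol h) u_sol (z_sol h)
    (dJ h).
- exact: residual_adjoint_eq0 (Vh_sub h) (uh_sol h) (uhp_sol h) (zhp_sol h)
    (dJ h).
Qed.
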